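(* Define polynomials $H_m(z)\in\mathbb{Z}[z]$, $m\ge0$, by the power series identity $$\sum_{m\ge0}H_m(z)t^m=\frac{1}{1-t+zt^3}.$$ Let $n\ge3$ be an integer. Then, for all integers $r\ge1$, $$\Phi_{n,r}(x)=x^{(n-2)r+2}\,H_{r+2}(x^{-n}).$$
   Context: For integers $n\ge3$ and $r\ge1$, the digraph $\Gamma_{n,r}$ has vertex set $V(\Gamma_{n,r})=\{1,2,\dots,rn-2r+2\}$ and directed edge set $E(\Gamma_{n,r})$ defined by $E(\Gamma_{n,1})=\{(j,j+1):1\le j\le n-1\}\cup\{(n,1)\}$; $E(\Gamma_{n,2})=E(\Gamma_{n,1})\cup\{(1,n+1)\}\cup\{(j,j+1):n+1\le j\le 2n-3\}\cup\{(2n-2,n)\}$; and for $r\ge3$, $E(\Gamma_{n,r})=E(\Gamma_{n,2})\cup\bigcup_{i=1}^{r-2}F_i$, where $F_i=\{(in-2i+2,\,in+n-2i+1)\}\cup\{(j,j+1):in+n-2i+1\le j\le in+2n-2i-3\}\cup\{(in+2n-2i-2,\,in+n-2i)\}$. (For $n=3$ the middle path parts are empty.) The adjacency matrix $A_{n,r}$ is the $(0,1)$-matrix indexed by $V(\Gamma_{n,r})$ whose $(u,v)$-entry is $1$ if and only if $(u,v)\in E(\Gamma_{n,r})$, and $\Phi_{n,r}(x)=\det(xI-A_{n,r})\in\mathbb Z[x]$. The displayed identity is one of Laurent polynomials in $x$. *)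

(* Defs.v *)
From mathcomp Require Import all_boot all_order all_algebra.

Set Implicit Arguments.
Unset Strict Implicit.
Unset Printing Implicit Defensive.

Import GRing.Theory.
Local Open Scope ring_scope.

Section Digraph.
Local Open Scope nat_scope.

(* Vertices are labelled from 1 and edge sets are boolean relations on labels.
   For 3 <= n and 1 <= i, no subtraction below is truncated. *)

Definition edges1 (n : nat) : rel nat := fun u v =>
  (1 <= u <= n - 1) && (v == u + 1) || (u == n) && (v == 1).

Definition edges2 (n : nat) : rel nat := fun u v =>
  [|| edges1 n u v,
      (u == 1) && (v == n + 1),
      (n + 1 <= u <= 2 * n - 3) && (v == u + 1)
    | (u == 2 * n - 2) && (v == n)].

Definition edgesF (n i : nat) : rel nat := fun u v =>
  [|| (u == i * n - 2 * i + 2) && (v == i * n + n - 2 * i + 1),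
      (i * n + n - 2 * i + 1 <= u <= i * n + 2 * n - 2 * i - 3) && (v == u + 1)
    | (u == i * n + 2 * n - 2 * i - 2) && (v == i * n + n - 2 * i)].

(* The value at r = 0 is irrelevant. *)
Definition edges (n r : nat) : rel nat := fun u v =>
  match r with
  | 0 | 1 => edges1 n u v
  | 2 => edges2 n u v
  | _ => edges2 n u v || has (fun i => edgesF n i u v) (iota 1 (r - 2))
  end.

Definition nvertices (n r : nat) : nat := r * n - 2 * r + 2.

End Digraph.

(* The ordinal u : 'I_(nvertices n r) stands for the vertex u + 1. *)
Definition adjacency (n r : nat) : 'M[int]_(nvertices n r) :=
  \matrix_(u, v) (edges n r u.+1 v.+1)%:R.

Definition Phi (n r : nat) : {poly int} := char_poly (adjacency n r).

(* A formal power series over R is given by its sequence of coefficients;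
   fps_mul is the Cauchy product. *)
Definition fps_mul (R : pzSemiRingType) (a b : nat -> R) : nat -> R :=
  fun k => \sum_(i < k.+1) a i * b (k - i)%N.

Definition fps_one (R : pzSemiRingType) : nat -> R := fun k => (k == 0)%:R.

(* 1 - t + z t^3 in Z[z][t]: the outer indeterminate is t, the inner one z. *)
Definition H_denom : {poly {poly int}} := 1 - 'X + 'X%:P * 'X^3.

(* \sum_m H m * t^m = 1 / (1 - t + z t^3) in Z[z][[t]]. *)
Definition H_generating (H : nat -> {poly int}) : Prop :=
  fps_mul (fun i => H_denom`_i) H =1 fps_one {poly int}.

Lemma H_denom_coef i :
  H_denom`_i = (i == 0)%:R - (i == 1)%:R + (i == 3)%:R * 'X :> {poly int}.
Proof.
by rewrite /H_denom coefD coefB coef1 coefX coefCM coefXn mulrC.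
Qed.

Lemma H_generating_rec (H : nat -> {poly int}) :
  H_generating H <->
  [/\ H 0 = 1, H 1 = 1, H 2 = 1 & forall m, H m.+3 = H m.+2 - 'X * H m].
Proof.
have low k : (k < 3)%N ->
    fps_mul (fun i => H_denom`_i) H k = H k - (if k is k'.+1 then H k' else 0).
  move=> k3; rewrite /fps_mul; case: k k3 => [|[|[|k]]] // _;
  by rewrite !big_ord_recl big_ord0 /= !H_denom_coef /= 
    ?(mul0r, mul1r, subr0, addr0, sub0r, mulN1r).
have high m :
    fps_mul (fun i => H_denom`_i) H m.+3 = H m.+3 - H m.+2 + 'X * H m.
  rewrite /fps_mul !big_ord_recl big1 => [|i _]; last first.
    by rewrite H_denom_coef /= !(mul0r, subr0, addr0).
  rewrite !H_denom_coef /= !(mul0r, mul1r, subr0, addr0, sub0r, mulN1r, add0r).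
  by rewrite /bump /= !subSS !subn0 addrA.
split=> [gH | [H0 H1 H2 HS] [|[|[|m]]]].
- have := gH 0; have := gH 1; have := gH 2; rewrite !low // /fps_one /= subr0.
  move=> /eqP + /eqP + H0; rewrite !subr_eq0 H0 => /eqP H2 /eqP H1.
  split=> //; first by rewrite H2.
  move=> m; have := gH m.+3; rewrite high /fps_one /= => /eqP.
  by rewrite addr_eq0 subr_eq => /eqP ->; rewrite addrC.
- by rewrite low // H0 subr0.
- by rewrite low // H1 H0 /fps_one addrN.
- by rewrite low // H2 H1 /fps_one addrN.
- by rewrite high HS /fps_one /= [_ - _ - _]addrAC subrr sub0r addNr.
Qed.

Lemma H_generating_ex : exists H, H_generating H.
Proof.
pose step (s : {poly int} * {poly int} * {poly int}) :=
  (s.1.2, s.2, s.2 - 'X * s.1.1).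
exists (fun m => (iter m step (1, 1, 1)).1.1).
by apply/H_generating_rec; split.
Qed.

Lemma H_generating_uniq (H1 H2 : nat -> {poly int}) :
  H_generating H1 -> H_generating H2 -> H1 =1 H2.
Proof.
move=> /H_generating_rec[a0 a1 a2 aS] /H_generating_rec[b0 b1 b2 bS] m.
suff [] : [/\ H1 m = H2 m, H1 m.+1 = H2 m.+1 & H1 m.+2 = H2 m.+2] by [].
elim: m => [|m [IH0 IH1 IH2]]; first by rewrite a0 a1 a2 b0 b1 b2.
by split=> //; rewrite aS bS IH0 IH2.
Qed.

(* Main.v *)
Require Import Defs.
From mathcomp Require Import all_boot all_order all_algebra.
From mathcomp Require Import fingroup perm zify.

Set Implicit Arguments.
Unset Strict Implicit.
Unset Printing Implicit Defensive.

Import GRing.Theory.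
Local Open Scope ring_scope.

(** Put m = n - 2.  The digraph is built from ears, paths with m new vertices
    each.  Call hubs the vertices e_0 = 2, e_1 = 1 and e_(k+2) = the last vertex
    of the ear number k+1, that is (k+1)m + 2.  In these terms the digraph is
    uniform in k: every hub e_(k+1) has an edge to e_k, and a path with m edges
    leads from the start hub e_k of an ear, through m - 1 inner vertices, to
    its last vertex e_(k+2).  There are r + 2 hubs and r(m - 1) inner vertices.

    Let M = xI - A, over the fraction field of Z[x].  Among the incoming edges
    of a vertex, the only one that does not come along a path is the edge from
    e_(k+1) to e_k.  So a row vector g with (gM)_v = 0 for v other than the
    last hub e_(r+1) can be computed column by column: along a path each step
    divides the entry by x, and at the hubs the entries a_k = g(e_k) satisfy
      a_(k+1) = x a_k  for k < 2,   a_(k+3) = x a_(k+2) - x^-(m-1) a_k .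
    From a_0 = 1 this recursion gives a_k = x^k H_k(x^-n), because H_(k+3) =
    H_(k+2) - z H_k and n = m + 2.  The only entry of gM that survives is the
    one at e_(r+1), where the edge from the missing hub e_(r+2) would have
    contributed a_(r+2); hence it equals a_(r+2).

    As g(e_0) = 1, replacing the row e_0 of M by gM keeps the determinant
    ([det_row_combination]).  The row e_0 now has one nonzero entry, in the
    column e_(r+1); if the row e_(k+1) is matched with the column e_k, where the
    edge from e_(k+1) to e_k puts -1, and every inner row with its own column,
    the matrix is triangular ([det_perm_trig]).  The matched entries are
    a_(r+2), r + 1 times -1, and r(m - 1) times x, and the matching is a cycle
    of length r + 2, whose sign (-1)^(r+1) compensates the -1's.  So
      det M = a_(r+2) x^(r(m-1)) = x^(rm+2) H_(r+2)(x^-n) .  *)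

(** * Determinants and cyclic permutations *)

(** Expanding along the new row gives the entry i0 of (gA) adj(A) = det(A) g:
    the cofactors of that row do not see the row itself. *)
Lemma det_row_combination (R : comNzRingType) (n : nat) (A : 'M[R]_n)
    (g : 'rV[R]_n) (i0 : 'I_n) :
  \det (\matrix_(i, j) if i == i0 then (g *m A) 0 j else A i j)
    = g 0 i0 * \det A.
Proof.
rewrite (expand_det_row _ i0).
transitivity ((g *m A *m \adj A) 0 i0); last first.
  by rewrite -mulmxA mul_mx_adj mul_mx_scalar mxE mulrC.
rewrite [RHS]mxE; apply: eq_bigr => j _; rewrite mxE eqxx; congr (_ * _).
rewrite mxE /cofactor; congr (_ * \det _); apply/matrixP => k l.
by rewrite !mxE eq_sym (negPf (neq_lift _ _)).
Qed.

(** Triangularity with respect to a matching s of rows with columns.  If every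
    A i (t i) is nonzero, then u = s^-1 t never raises rk and lowers it wherever
    u moves a point; since a permutation preserves the sum of the rk i, u moves
    nothing.  So s is the only permutation that contributes. *)
Lemma det_perm_trig (R : comNzRingType) (n : nat) (A : 'M[R]_n) (s : 'S_n)
    (rk : 'I_n -> nat) :
  (forall i j, A i (s j) != 0 -> i != j -> (rk j < rk i)%N) ->
  \det A = (-1) ^+ s * \prod_i A i (s i).
Proof.
move=> trigA; rewrite /determinant (bigD1 s) //=.
rewrite [X in _ + X]big1 ?addr0 // => t t_s.
suff /existsP[i /eqP Ai0] : [exists i, A i (t i) == 0].
  by rewrite (bigD1 i) //= Ai0 mul0r mulr0.
apply: contraR t_s => /existsPn nzA.
pose u := (t * s^-1)%g; have su i : s (u i) = t i by rewrite permM permKV.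
have le_rk i : (rk (u i) <= rk i)%N.
  have [<-//|ne] := eqVneq i (u i).
  by apply/ltnW/trigA => //; rewrite su.
have /eqP eq_sum : (\sum_i rk (u i) == \sum_i rk i)%N.
  by rewrite [X in _ == X](reindex_inj (@perm_inj _ u)).
have eq_rk i : rk (u i) = rk i.
  apply/eqP; move/eqP: eq_sum.
  have /leqif_sum/= -> : forall i, true ->
      (rk (u i) <= rk i ?= iff (rk (u i) == rk i))%N.
    move=> k _; apply/leqifP; case: eqP => // /eqP.
    by rewrite ltn_neqAle le_rk andbT.
  by move/forallP/(_ i).
apply/eqP/permP => i; rewrite -su; congr (s _); apply/eqP; apply: contraT => ne.
have := trigA i (u i); rewrite su eq_rk ltnn => lt_irr.
by apply: lt_irr => //; rewrite eq_sym.
Qed.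

(** The cycle is built as a product of k transpositions, so that its parity
    comes for free. *)
Lemma cycle_perm_ex (T : finType) (e : nat -> T) (k : nat) :
  {in [pred i | i <= k]%N &, injective e} ->
  exists s : {perm T},
    [/\ s (e 0%N) = e k,
        forall i, (i < k)%N -> s (e i.+1) = e i,
        forall x, (forall i, (i <= k)%N -> x != e i) -> s x = x
      & s = odd k :> bool].
Proof.
elim: k => [|k IHk] inj_e.
  by exists 1%g; split=> *; rewrite ?perm1 ?odd_perm1.
have [|s [s0 sS s_id s_odd]] := IHk.
  by move=> i j /[!inE] ik jk; apply: inj_e; rewrite inE leqW.
have e_ne i j : (i <= k.+1)%N -> (j <= k.+1)%N -> i != j -> e i != e j.
  by move=> ik jk; apply: contra_neq; apply: inj_e; rewrite inE.
exists (s * tperm (e k) (e k.+1))%g; split=> [|i|x x_ne|].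
- by rewrite permM s0 tpermL.
- rewrite ltnS leq_eqVlt => /predU1P[->|ik].
    rewrite permM s_id ?tpermR // => j jk; apply: e_ne; lia.
  by rewrite permM sS // tpermD //; apply: e_ne; lia.
- rewrite permM s_id => [|i ik]; last by apply: x_ne; lia.
  by rewrite tpermD // eq_sym x_ne.
- rewrite odd_permM s_odd odd_tperm e_ne ?addbT //; lia.
Qed.

(** * The edges, sorted by their heads *)

Section Graph.
Local Open Scope nat_scope.

(** From here on vertices are counted from 0, as ordinals are: v stands for the
    vertex labelled v + 1, and e_0, e_1 are the vertices 1 and 0.  For 2 <= v,
    this is the tail of the edge by which a path arrives at v.  The vertices
    v = qm + 2 are the first vertices of the ears, entered from the hub e_q. *)
Definition path_pred (m v : nat) : nat :=
  if (m %| v - 2) && (v != 2) then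
    if v == m + 2 then 0 else v - m - 1
  else v - 1.

(** For v = e_k, this is e_(k+1). *)
Definition hub_next (m v : nat) : nat :=
  if v == 1 then 0 else if v == 0 then m + 1 else v + m.

(** The numbering of the hubs starts with the label 2, not 1, so that the first
    n-cycle 1, 2, ..., n, 1 is an ear from e_0 to e_2 = n closed by the edges
    from e_2 to e_1 and from e_1 to e_0, like all later n-cycles. *)
Definition hub (m k : nat) : nat :=
  match k with 0 => 1 | 1 => 0 | k'.+2 => k'.+1 * m + 1 end.

Lemma dvdn_offset m q j : 0 < m -> j < m -> (m %| q * m + j) = (j == 0).
Proof. by move=> m0 jm; rewrite dvdn_addr ?dvdn_mull // /dvdn modn_small. Qed.

(** The set F_i for n = m + 2, with labels counted from 1.  The ear added for
    r = 2 has the same form for i = 0, except that it starts at the label 1 and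
    not at 2. *)
Definition edges_block m i u v :=
 [|| (u == if i == 0 then 1 else i * m + 2) && (v == i.+1 * m + 3),
      (i.+1 * m + 3 <= u <= i.+2 * m + 1) && (v == u + 1)
    | (u == i.+2 * m + 2) && (v == i.+1 * m + 2)].

Lemma edges_blocks m r u v : 0 < r ->
  edges (m + 2) r u v =
  edges1 (m + 2) u v || has (fun i => edges_block m i u v) (iota 0 (r - 1)).
Proof.
have F_block i : 0 < i -> edgesF (m + 2) i u v = edges_block m i u v.
  move=> i0; rewrite /edgesF /edges_block (gtn_eqF i0).
  have -> : i * (m + 2) = i * m + 2 * i by lia.
  by rewrite !mulSn; move: (i * m) => p; lia.
have edges2E : edges2 (m + 2) u v = edges1 (m + 2) u v || edges_block m 0 u v.
  rewrite /edges2 /edges_block /=; lia.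
case: r => [|[|[|r]]] // _; first by rewrite /= orbF.
  by rewrite /= edges2E orbF.
rewrite /edges edges2E -orbA (_ : iota 0 _ = 0 :: iota 1 (r.+3 - 2)) //.
congr (_ || (_ || _)).
by apply: eq_in_has => i; rewrite mem_iota => /andP[/F_block].
Qed.

(** Sorting the edges by their heads is what makes the columns of xI - A easy to
    evaluate: a head has at most two incoming edges. *)
Lemma edges_by_head m r u v : 0 < m -> 0 < r ->
  u < r * m + 2 -> v < r * m + 2 ->
  edges (m + 2) r u.+1 v.+1 =
  (2 <= v) && (u == path_pred m v) || (m %| v - 1) && (u == hub_next m v).
Proof.
move=> m0 r0 ub vb.
rewrite edges_blocks //; apply/idP/idP.
  case/orP=> [|/hasP[i]].
    rewrite /edges1 /path_pred /hub_next.
    case/orP=> /andP[].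
      move=> u_le /eqP ?; have ->: v = u.+1 by lia.
      case: (posnP u) => [->|u_gt0]; first by rewrite dvdn0.
      have -> : u.+1 - 2 = 0 * m + (u - 1) by lia.
      apply/orP; left; rewrite dvdn_offset //; do ?case: ifP; lia.
    move=> /eqP ? /eqP ?; have -> : v = 0 by lia.
    rewrite sub0n dvdn0 /=; do ?case: ifP; lia.
  rewrite mem_iota => /andP[_ ir].
  rewrite /edges_block /path_pred /hub_next.
  case/or3P=> /andP[].
  - move=> /eqP ue /eqP ?; have ve : v = i.+1 * m + 2 by lia.
    apply/orP; left; have -> : v - 2 = i.+1 * m + 0 by lia.
    rewrite dvdn_offset //; case: (posnP i) => [i0|i_gt0].
      by rewrite i0 /= in ue ve *; do ?case: ifP; lia.
    rewrite gtn_eqF //= in ue; rewrite (_ : v == m + 2 = false).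
      by do ?case: ifP; lia.
    apply/negbTE; apply/eqP; nia.
  - move=> u_le /eqP ?; have ve : v = u.+1 by lia.
    have -> : v - 2 = i.+1 * m + (u.+1 - (i.+1 * m + 2)) by lia.
    by apply/orP; left; rewrite dvdn_offset //; do ?case: ifP; lia.
  - move=> /eqP ? /eqP ?; have ve : v = i.+1 * m + 1 by lia.
    have -> : v - 1 = i.+1 * m + 0 by lia.
    rewrite dvdn_offset //; do ?case: ifP; lia.
case/orP=> /andP[].
  move=> v2 /eqP; rewrite /path_pred.
  have := divn_eq (v - 2) m; have := ltn_pmod (v - 2) m0.
  move: (_ %/ m) (_ %% m) => q j jm ve; rewrite ve dvdn_offset //.
  have qr : q < r by apply: contraTT vb; rewrite -!leqNgt; nia.
  case: q ve qr => [|i] ve qr.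
    by do ?case: ifP; move=> *; apply/orP; left; rewrite /edges1; lia.
  move=> ue; apply/orP; right; apply/hasP; exists i.
    by rewrite mem_iota; lia.
  rewrite /edges_block; apply/or3P.
  case: (posnP j) ue => [j0|j_gt0] /= ue; last by apply: Or32; lia.
  apply: Or31; case: i ve qr ue => [|i] ve qr.
    by rewrite /=; do ?case: ifP; lia.
  by rewrite /=; do ?case: ifP; nia.
case: v vb => [|[|v]] vb.
- move=> _ /eqP ue; rewrite /hub_next /= in ue.
  by apply/orP; left; rewrite /edges1; lia.
- move=> _ /eqP ue; rewrite /hub_next /= in ue.
  by apply/orP; left; rewrite /edges1; lia.
rewrite subn1 /= => /dvdnP[q ve] /eqP; rewrite /hub_next /= => ue.
case: q ve => // i ve.
have ir : i.+1 < r by apply: contraTT ub; rewrite -!leqNgt; nia.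
apply/orP; right; apply/hasP; exists i; first by rewrite mem_iota; lia.
by rewrite /edges_block; apply/or3P; apply: Or33; lia.
Qed.

(** * Hubs and inner vertices *)

Lemma path_pred_lt m v : 0 < m -> 2 <= v -> path_pred m v < v.
Proof. by rewrite /path_pred => m0 v2; do ?case: ifP; lia. Qed.

Lemma hub_next_hub m k : 0 < m -> hub_next m (hub m k) = hub m k.+1.
Proof.
case: k => [|[|k]] m0; rewrite /hub_next /= ?mul1n //.
do ?case: ifP; lia.
Qed.

Lemma dvdn_hub m k : m %| hub m k - 1.
Proof.
by case: k => [|[|k]] /=; rewrite ?subnn ?sub0n ?dvdn0 // addnK dvdn_mull.
Qed.

(** The hub e_0 is excluded: e_1 lies below it. *)
Lemma hub_lt m j k : 0 < m -> 0 < j -> j < k -> hub m j < hub m k.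
Proof. by case: j => [|[|j]] //; case: k => [|[|k]] //= m0 _ jk; nia. Qed.

Lemma hub_neq1 m k : 0 < m -> 0 < k -> hub m k != 1.
Proof. by case: k => [|[|k]] //= m0 _; nia. Qed.

Lemma hub_inj m : 0 < m -> injective (hub m).
Proof.
move=> m0 j k; case: (ltngtP j k) => // [jk|jk] eq_h.
  case: j jk eq_h => [|j] jk eq_h; last by have := hub_lt m0 _ jk; lia.
  by have := hub_neq1 m0 jk; rewrite -eq_h.
case: k jk eq_h => [|k] jk eq_h; last by have := hub_lt m0 _ jk; lia.
by have := hub_neq1 m0 jk; rewrite eq_h.
Qed.

Lemma hub_bound m r k : 0 < m -> 0 < r -> (hub m k < r * m + 2) = (k <= r.+1).
Proof.
by case: k => [|[|k]] m0 r0; rewrite ?addn2 //= addn1 !ltnS leq_pmul2r.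
Qed.

Variant vertex_spec m r : nat -> Type :=
| VertexHub k of k <= r.+1 : vertex_spec m r (hub m k)
| VertexInner q j of 0 < j & j < m : vertex_spec m r (q * m + 1 + j).

Lemma vertexP m r v : 0 < m -> v < r * m + 2 -> vertex_spec m r v.
Proof.
move=> m0; case: v => [|[|v]] vb; first exact: (VertexHub m (isT : 1 <= r.+1)).
  exact: (VertexHub m (isT : 0 <= r.+1)).
have := divn_eq v.+1 m; have := ltn_pmod v.+1 m0.
move: (_ %/ m) (_ %% m) => q j jm ve.
case: (posnP j) => [j0|j_gt0]; last first.
  have -> : v.+2 = q * m + 1 + j by lia.
  exact: VertexInner.
case: q ve => [|k] ve; first by lia.
have -> : v.+2 = hub m k.+2 by rewrite /=; lia.
by apply: VertexHub; apply: contraTT vb; rewrite -!leqNgt; nia.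
Qed.

Lemma inner_neq_hub m q j k : 0 < j -> j < m -> q * m + 1 + j != hub m k.
Proof.
move=> j0 jm; apply/eqP => e.
have := dvdn_hub m k; rewrite -e.
have -> : q * m + 1 + j - 1 = q * m + j by lia.
by rewrite dvdn_offset; lia.
Qed.

(** * A row vector that almost annihilates xI - A *)

Section Weights.
Local Open Scope ring_scope.

(** The entries of g: a_k at the hub e_k, and x^-j a_q at the j-th inner vertex
    of the ear that starts at e_q. *)
Definition weight (F : fieldType) (x : F) (a : nat -> F) (m w : nat) : F :=
  if w == 1%N then a 0%N else
  let q := ((w - 1) %/ m)%N in let j := ((w - 1) %% m)%N in
  if j == 0%N then a q.+1 else x ^- j * a q.

Lemma weight_hub (F : fieldType) (x : F) (a : nat -> F) m k : (0 < m)%N ->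
  weight x a m (hub m k) = a k.
Proof.
case: k => [|[|k]] m0; rewrite /weight //=.
  by rewrite sub0n mod0n div0n.
by rewrite gtn_eqF ?addnK ?modnMl ?mulnK //; nia.
Qed.

Lemma weight_inner (F : fieldType) (x : F) (a : nat -> F) m q j :
  (0 < j)%N -> (j < m)%N -> weight x a m (q * m + 1 + j) = x ^- j * a q.
Proof.
move=> j0 jm; rewrite /weight gtn_eqF; last by lia.
have -> : (q * m + 1 + j - 1 = q * m + j)%N by lia.
rewrite divnMDl ?modnMDl; last by lia.
by rewrite modn_small // divn_small // addn0 gtn_eqF.
Qed.

(** The vertex qm + 2 + i is the vertex number i + 1 of the ear that starts at
    e_q, and i may be m - 1: the last vertex is a hub, whose own weight does not
    follow the rule x^-j a_q, while its predecessor's does. *)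
Lemma weight_path_pred (F : fieldType) (x : F) (a : nat -> F) m q i :
  (i < m)%N -> weight x a m (path_pred m (q * m + 2 + i)) = x ^- i * a q.
Proof.
move=> im; have m0 : (0 < m)%N by lia.
rewrite /path_pred.
have -> : (q * m + 2 + i - 2 = q * m + i)%N by lia.
rewrite dvdn_offset //; case: posnP => [->|i0] /=; last first.
  have -> : (q * m + 2 + i - 1 = q * m + 1 + i)%N by lia.
  exact: weight_inner.
rewrite expr0 invr1 mul1r -(weight_hub x a q m0); congr (weight _ _ _ _).
case: q => [|[|q]]; rewrite ?mul1n ?mul0n //=.
  rewrite ifT; last by lia.
  by rewrite ifT //; lia.
rewrite ifT; last by nia.
rewrite ifF; last by nia.
lia.
Qed.

Lemma sum_pick (R : pzRingType) (N : nat) (g : nat -> R) (p : nat) :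
  \sum_(u < N) g u * (u == p :> nat)%:R = if (p < N)%N then g p else 0.
Proof.
case: ifP => [pN|/negbT]; last first.
  rewrite -leqNgt => pN; apply: big1 => u _.
  by rewrite ltn_eqF ?mulr0 //; apply: leq_trans pN.
rewrite (bigD1 (Ordinal pN)) //= eqxx mulr1 big1 ?addr0 // => u.
by rewrite -val_eqE /= => /negPf ->; rewrite mulr0.
Qed.

(** The size is a variable N, to be equated with rm + 2, because the number of
    vertices in the theorem is written with truncated subtraction. *)
Definition graph_mx (F : fieldType) (x : F) (m r N : nat) : 'M[F]_N :=
  \matrix_(u, v) (x *+ (u == v) - (edges (m + 2) r u.+1 v.+1)%:R).

(** Zero at an inner vertex since weights are divided by x along an ear, and
    zero at a hub e_k with k <= r by the recursion; at e_(r+1) the term a_(r+2)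
    of the recursion has no vertex that carries it. *)
Lemma weight_graph_mx (F : fieldType) (x : F) (a : nat -> F) m r N
    (v : 'I_N) : (0 < m)%N -> (0 < r)%N -> N = (r * m + 2)%N ->
    x != 0 -> x * a 0%N = a 1%N -> x * a 1%N = a 2%N ->
    (forall k, a k.+3 = x * a k.+2 - x ^- m.-1 * a k) ->
  ((\row_u weight x a m u) *m graph_mx x m r N) 0 v =
    if v == hub m r.+1 :> nat then a r.+2 else 0.
Proof.
move=> m0 r0 eN x0 a1 a2 aS.
have v_lt : (v < r * m + 2)%N by rewrite -eN.
pose g := weight x a m.
have -> : ((\row_u weight x a m u) *m graph_mx x m r N) 0 v =
    x * g v - (if (2 <= v)%N then g (path_pred m v) else 0)
     - (if ((m %| v - 1) && (hub_next m v < N))%N then g (hub_next m v)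
        else 0).
  rewrite mxE.
  transitivity (\sum_(u < N) (x * (g u * (u == v :> nat)%:R)
      - (2 <= v)%N%:R * (g u * (u == path_pred m v :> nat)%:R)
      - (m %| v - 1)%N%:R * (g u * (u == hub_next m v :> nat)%:R))).
    apply: eq_bigr => u _; rewrite !mxE -/g edges_by_head -?eN //.
    (* The two kinds of edges are disjoint: path_pred lowers v, and for 2 <= v
       hub_next raises it. *)
    have dis : ((2 <= v)%N && (u == path_pred m v :> nat)) ==>
        ~~ ((m %| v - 1)%N && (u == hub_next m v :> nat)).
      apply/implyP => /andP[v2 /eqP ->].
      have := path_pred_lt m0 v2; rewrite /hub_next negb_and.
      by move=> lt_p; apply/orP; right; do ?case: ifP; lia.
    have -> : ((2 <= v)%N && (u == path_pred m v :> nat)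
          || (m %| v - 1)%N && (u == hub_next m v :> nat))%:R
        = (2 <= v)%N%:R * (u == path_pred m v :> nat)%:R
          + (m %| v - 1)%N%:R * (u == hub_next m v :> nat)%:R :> F.
      move: dis; rewrite -!natrM -natrD !mulnb.
      by case: andb => /= [/negPf ->|_].
    rewrite -val_eqE /= mulrBr mulrDr -[x *+ _]mulr_natr opprD addrA.
    by congr (_ - _ - _); rewrite mulrCA.
  rewrite !big_split /= -!mulr_sumr !sumrN -!mulr_sumr !sum_pick ltn_ord.
  congr (_ - _ - _).
    case: (ltnP 1 v) => v2; rewrite /= ?mulr1n ?mulr0n ?mul0r ?mul1r //.
    by rewrite ifT // (ltn_trans (path_pred_lt m0 v2)).
  by case: (m %| _)%N; rewrite /= ?mulr1n ?mulr0n ?mul0r ?mul1r.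
rewrite {}/g; case: (vertexP m0 v_lt) => [k k_le|q j j0 jm]; last first.
  rewrite ifT; last by lia.
  have e : (q * m + 1 + j = q * m + 2 + j.-1)%N by lia.
  rewrite [in path_pred _ _]e weight_path_pred; last by lia.
  have -> : (q * m + 1 + j - 1 = q * m + j)%N by lia.
  rewrite dvdn_offset // (gtn_eqF j0) andFb subr0.
  rewrite (negPf (inner_neq_hub _ _ j0 jm)).
  rewrite weight_inner // -{1}(prednK j0).
  by rewrite exprS invfM mulrA mulVKf // subrr.
rewrite dvdn_hub hub_next_hub // {1}eN hub_bound // !weight_hub // andTb ltnS.
rewrite (inj_eq (hub_inj m0)).
case: k k_le => [|[|k]] k_le /=.
- by rewrite a1 subr0 subrr.
- by rewrite r0 a2 subr0 eqSS ltn_eqF // subrr.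
rewrite ifT; last by nia.
have -> : (k.+1 * m + 1 = k * m + 2 + m.-1)%N by lia.
rewrite weight_path_pred; last by lia.
rewrite -aS !eqSS; move: k_le; rewrite !ltnS leq_eqVlt.
case/predU1P=> [<-|k_lt]; first by rewrite ltnn eqxx subr0.
by rewrite k_lt ltn_eqF // subrr.
Qed.

(** * The determinant of xI - A *)

Lemma det_graph_mx (F : fieldType) (x : F) (a : nat -> F) m r N :
    (0 < m)%N -> (0 < r)%N -> N = (r * m + 2)%N -> x != 0 ->
    a 0%N = 1 -> x * a 0%N = a 1%N -> x * a 1%N = a 2%N ->
    (forall k, a k.+3 = x * a k.+2 - x ^- m.-1 * a k) ->
  \det (graph_mx x m r N) = a r.+2 * x ^+ (r * m.-1).
Proof.
move=> m0 r0 eN x0 a0 a1 a2 aS; case: N eN => [|N] eN; first by lia.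
set M := graph_mx x m r N.+1; pose g := \row_(u < N.+1) weight x a m u.
have lt_hub k : (k <= r.+1)%N -> (hub m k < N.+1)%N by rewrite eN hub_bound.
pose e k : 'I_N.+1 := inord (hub m k).
have e_val k : (k <= r.+1)%N -> e k = hub m k :> nat.
  by move=> kr; rewrite inordK ?lt_hub.
have e_inj : {in [pred k | k <= r.+1]%N &, injective e}.
  move=> j k; rewrite !inE => jr kr /(congr1 val).
  by rewrite /= !e_val // => /(hub_inj m0).
(* s matches the row e_(k+1) with the column e_k, and the row e_0, which is
   going to be replaced, with the column e_(r+1). *)
have [s [s0 sS s_id s_odd]] := cycle_perm_ex e_inj.
have gM v : (g *m M) 0 v = if v == e r.+1 then a r.+2 else 0.
  by rewrite (weight_graph_mx _ m0 r0 eN x0 a1 a2 aS) -val_eqE /= e_val.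
have <- : \det (\matrix_(i, j) if i == e 0%N then (g *m M) 0 j else M i j)
    = \det M.
  by rewrite det_row_combination mxE e_val // weight_hub // a0 mul1r.
set B := \matrix_(i, j) _.
have B_row0 v : B (e 0%N) v = if v == e r.+1 then a r.+2 else 0.
  by rewrite mxE eqxx gM.
have B_row u v : u != e 0%N -> B u v = x *+ (u == v) -
    ((2 <= v)%N && (u == path_pred m v :> nat)
     || (m %| v - 1)%N && (u == hub_next m v :> nat))%:R.
  by move=> /negPf u0; rewrite mxE u0 mxE edges_by_head // -eN.
have val_lt (u : 'I_N.+1) : (u < r * m + 2)%N by rewrite -eN.
have e_or (u : 'I_N.+1) : {k | (k <= r.+1)%N & u = e k} +
    ((forall k, u != hub m k :> nat) /\ ~~ (m %| u - 1)%N).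
  case E : (nat_of_ord u) / (vertexP m0 (val_lt u)) => [k kr|q j j0 jm].
    by left; exists k => //; apply: val_inj; rewrite /= e_val.
  right; split=> [k|]; first exact: inner_neq_hub.
  have -> : (q * m + 1 + j - 1 = q * m + j)%N by lia.
  by rewrite dvdn_offset // -lt0n.
(* Outside the row e_0, a nonzero entry of the column v <> e_0 is the matched
   one, or lies in the row v or path_pred m v < v; and s^-1 sends v to v, to a
   later hub or to e_0.  The column e_0 has only the matched entry outside the
   row e_0.  So decreasing order, with e_0 moved to the bottom, makes the matrix
   triangular. *)
pose rk (u : 'I_N.+1) := if u == e 0%N then 0%N else (N.+1 - u)%N.
have s_inner (u : 'I_N.+1) : (forall k, u != hub m k :> nat) -> s u = u.
  by move=> ne; apply: s_id => i ir; rewrite -val_eqE /= e_val.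
have e_neq0 k : (k <= r)%N -> e k.+1 != e 0%N.
  by move=> kr; apply/negP => /eqP/e_inj; rewrite !inE => /(_ kr isT).
rewrite (@det_perm_trig _ _ B s rk); last first.
  move=> i j Bij ij; case: (e_or j) => [[k kr je]|[j_ne j_dvd]].
    case: k kr je => [|k] kr je.
      by move: ij; rewrite je /rk eqxx => /negPf ->; rewrite subn_gt0.
    move: Bij; rewrite je sS //.
    have [->|i0] := eqVneq i (e 0%N).
      rewrite B_row0; case: (e k =P e r.+1) => [/e_inj|_]; last by rewrite eqxx.
      by rewrite !inE; lia.
    rewrite B_row // e_val ?(ltnW kr) // dvdn_hub hub_next_hub //.
    have -> : (i == hub m k.+1 :> nat) = false.
      by apply/negbTE; rewrite -(e_val _ kr); move: ij; rewrite je.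
    rewrite andbF orbF /rk (negPf i0) (negPf (e_neq0 _ _)) // e_val //.
    move=> Bij; apply: ltn_sub2l; first by rewrite ltn_ord.
    have [ie|i_ne] := eqVneq i (e k).
      rewrite ie e_val ?(ltnW kr) //.
      case: k kr i0 {je Bij} ie => [|k] kr i0 ie; last exact: hub_lt.
      by rewrite ie eqxx in i0.
    move: Bij; rewrite (negPf i_ne) sub0r oppr_eq0.
    case: andP => [[v2 /eqP ->] _|]; last by rewrite eqxx.
    apply: ltn_trans (path_pred_lt m0 v2) _; apply: hub_lt => //.
    by case: k v2 {kr je i_ne}.
  move: Bij; rewrite s_inner // => Bij.
  have j0 : j != e 0%N by rewrite -val_eqE /= e_val.
  have [i0|i0] := eqVneq i (e 0%N).
    move: Bij; rewrite i0 B_row0.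
    case: (j =P e r.+1) => [je|_]; last by rewrite eqxx.
    by have := j_ne r.+1; rewrite je e_val // eqxx.
  rewrite /rk (negPf i0) (negPf j0).
  move: Bij; rewrite B_row // (negPf ij) sub0r oppr_eq0 (negPf j_dvd) orbF.
  case: andP => [[v2 /eqP ie] _|]; last by rewrite eqxx.
  by apply: ltn_sub2l; rewrite ?ltn_ord // ie path_pred_lt.
pose E := [set e k | k : 'I_r.+2].
have e_injE : {in predT &, injective (fun k : 'I_r.+2 => e k)}.
  by move=> j k _ _ /e_inj/val_inj->; rewrite ?inE // -ltnS.
rewrite (bigID (mem E)) /= big_imset; last by move=> j k _ _; apply: e_injE.
rewrite /= big_ord_recl /= s0 B_row0 eqxx.
have -> : \prod_(i < r.+1) B (e (bump 0 i)) (s (e (bump 0 i))) = (-1) ^+ r.+1.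
  rewrite (eq_bigr (fun _ => -1)) ?prodr_const ?card_ord // => i _.
  rewrite /bump /= add1n sS // B_row ?e_neq0 -1?ltnS //.
  have ir : (i <= r.+1)%N by rewrite ltnW.
  rewrite !e_val // dvdn_hub hub_next_hub // eqxx orbT -val_eqE /= !e_val //.
  by rewrite (inj_eq (hub_inj m0)) gtn_eqF // sub0r.
rewrite (eq_bigr (fun _ => x)); last first.
  move=> u uE; case: (e_or u) => [[k kr ue]|[u_ne u_dvd]].
    by case/imsetP: uE; exists (Ordinal (kr : k < r.+2)%N).
  rewrite s_inner // B_row -?val_eqE /= ?e_val // eqxx (negPf u_dvd) orbF.
  case: andP => [[v2 /eqP ue]|_]; last by rewrite subr0.
  by have := path_pred_lt m0 v2; rewrite -ue ltnn.
rewrite prodr_const s_odd -[(-1) ^+ odd _]signr_odd oddb signr_odd.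
rewrite mulrA mulrCA -expr2 sqrr_sign mulr1; congr (_ * _ ^+ _).
have := cardC (mem E); rewrite card_imset; last by move=> j k /e_injE ->.
rewrite !card_ord /predC /= => cE.
have rE : (r * m = r * m.-1 + r)%N by rewrite -{1}(prednK m0) mulnS addnC.
by apply/(@addnI r.+2); move: cE; move: (card _) => c; lia.
Qed.

End Weights.
End Graph.

(** * The characteristic polynomial *)

Theorem lemma5p1 (H : nat -> {poly int}) (hH : H_generating H)
    (n : nat) (hn : (3 <= n)%N) (r : nat) (hr : (1 <= r)%N) :
  let x : {fraction {poly int}} := tofrac 'X in
  tofrac (Phi n r) =
    x ^+ ((n - 2) * r + 2) * (map_poly intr (H (r + 2)%N)).[x ^- n].
Proof.
move=> x; have x0 : x != 0 by rewrite tofrac_eq0 polyX_eq0.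
have [H0 H1 H2 HS] := (H_generating_rec H).1 hH.
pose m := (n - 2)%N; have n_eq : n = (m + 2)%N by lia.
rewrite -/m; clearbody m; have m0 : (0 < m)%N by lia.
pose a k := x ^+ k * (map_poly intr (H k)).[x ^- n].
have -> : tofrac (Phi n r) = \det (graph_mx x m r (nvertices n r)).
  rewrite /Phi /char_poly -det_map_mx; congr (\det _); apply/matrixP => u v.
  rewrite !mxE -n_eq rmorphB /= rmorphMn /=; congr (_ - _).
  by rewrite rmorph_nat rmorph_nat.
rewrite (@det_graph_mx _ x a) //.
- rewrite /a addn2 mulrAC -exprD; congr (x ^+ _ * _); last by rewrite addn2.
  by rewrite -{2}(prednK m0) mulSn mulnC; lia.
- by rewrite /nvertices n_eq mulnDr [(2 * r)%N]mulnC addnK.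
- by rewrite /a H0 rmorph1 hornerC mulr1.
- by rewrite /a H0 H1 rmorph1 hornerC !mulr1.
- by rewrite /a H2 H1 rmorph1 hornerC !mulr1.
move=> k; rewrite /a HS rmorphB rmorphM /= map_polyX.
rewrite hornerD hornerN hornerM hornerX.
rewrite mulrBr [x * (_ * _)]mulrA -exprS; congr (_ - _).
rewrite !mulrA; congr (_ * _); apply: (mulIf (expf_neq0 n x0)).
rewrite mulfVK ?expf_neq0 // -[in RHS]mulrA -exprD mulrC.
have -> : (k + n = k.+3 + m.-1)%N by lia.
by rewrite exprD mulfK ?expf_neq0.
Qed.
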